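(* Let $R$ be a nonzero commutative ring with identity and let $G$ be an abelian group. The following conditions are equivalent. (1) $\mathfrak{N}(RG)=\Phi(N)$ for some subgroup $N\neq 1$ of $G$. (2) $R$ is reduced and $\operatorname{char} R=p$ for some prime $p\in\operatorname{supp} G$. Moreover, if these conditions are satisfied (with $p=\operatorname{char} R$), then $\mathfrak{N}(RG)=\Phi(G_p)$.
   Context: All groups are abelian and written multiplicatively. $RG$ is the group ring of $G$ over $R$. For a subgroup $N$ of $G$, $I(R,N)$ is the augmentation ideal of $RN$, i.e. the kernel of the $R$-algebra homomorphism $RN\to R$ sending every element of $N$ to $1$, and $\Phi(N)=I(R,N)RG$ is the ideal of $RG$ generated by $I(R,N)$. $\mathfrak{N}(A)$ denotes the nilradical of a ring $A$ and $\operatorname{char} A$ its characteristic. For a prime $p$, $G_p$ is the set of elements of $G$ whose order is a power of $p$, and $\operatorname{supp} G$ is the set of primes $p$ with $G_p\neq 1$. *)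

(* Defs.v *)
From HB Require Import structures.
From mathcomp Require Import all_boot all_algebra.
From mathcomp Require Import boolp classical_sets.
From mathcomp Require Import finmap.
From mathcomp.multinomials Require Import monalg.

Set Implicit Arguments.
Unset Strict Implicit.
Unset Printing Implicit Defensive.

Import GRing.Theory.

Local Open Scope fset_scope.
Local Open Scope classical_set_scope.
Local Open Scope ring_scope.

(* {malg R[G]} is the R-module of finitely supported functions G -> R, but its
   ring structure in monalg requires a monomial type (x * y = 1 must imply
   x = y = 1), which excludes groups. The alias below carries the convolution
   product instead; x@_g is the coefficient of x at g, and << c *g g >> is the
   element c g of RG. *)
Definition group_ring (R : nzRingType) (G : groupType) := {malg R[G]}.

HB.instance Definition _ (R : nzRingType) (G : groupType) :=
  GRing.Lmodule.on (group_ring R G).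

Section GroupRing.
Context {R : nzRingType} {G : groupType}.
Local Notation RG := (group_ring R G).
Implicit Types (x y z : RG) (g h : G) (c : R).

Definition gr_basis c g : RG := << c *g g >>.

Definition gr_one : RG := gr_basis 1 1%g.

Definition gr_mul x y : RG :=
  \sum_(g <- msupp x) \sum_(h <- msupp y) gr_basis (x@_g * y@_h) (g * h)%g.

Lemma gr_mulEw (d1 d2 : {fset G}) x y :
  (msupp x `<=` d1)%fset -> (msupp y `<=` d2)%fset ->
  gr_mul x y =
    \sum_(g <- d1) \sum_(h <- d2) gr_basis (x@_g * y@_h) (g * h)%g.
Proof.
move=> le_d1 le_d2; rewrite /gr_mul (big_fset_incl _ le_d1) /=.
  apply/eq_bigr => g _; apply/big_fset_incl => // h _ /mcoeff_outdom ->.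
  by rewrite mulr0 /gr_basis monalgU0.
move=> g _ /mcoeff_outdom xg; rewrite big1 // => h _.
by rewrite xg mul0r /gr_basis monalgU0.
Qed.

Lemma gr_mulUU c1 c2 g1 g2 :
  gr_mul (gr_basis c1 g1) (gr_basis c2 g2) = gr_basis (c1 * c2) (g1 * g2)%g.
Proof. by rewrite (gr_mulEw msuppU_le msuppU_le) !big_seq_fset1 !mcoeffUU. Qed.

Lemma gr_mulDl : left_distributive gr_mul +%R.
Proof.
move=> x y z.
rewrite (gr_mulEw (fsubsetUl (msupp x) (msupp y)) (fsubset_refl (msupp z))).
rewrite (gr_mulEw (fsubsetUr (msupp x) (msupp y)) (fsubset_refl (msupp z))).
rewrite (@gr_mulEw _ _ (x + y) z (msuppD_le x y) (fsubset_refl _)).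
rewrite -big_split /=; apply/eq_bigr => g _.
rewrite -big_split /=; apply/eq_bigr => h _.
by rewrite /gr_basis mcoeffD mulrDl monalgUD.
Qed.

Lemma gr_mulDr : right_distributive gr_mul +%R.
Proof.
move=> z x y.
rewrite (gr_mulEw (fsubset_refl (msupp z)) (fsubsetUl (msupp x) (msupp y))).
rewrite (gr_mulEw (fsubset_refl (msupp z)) (fsubsetUr (msupp x) (msupp y))).
rewrite (@gr_mulEw _ _ z (x + y) (fsubset_refl _) (msuppD_le x y)).
rewrite -big_split /=; apply/eq_bigr => g _.
rewrite -big_split /=; apply/eq_bigr => h _.
by rewrite /gr_basis mcoeffD mulrDr monalgUD.
Qed.

Lemma gr_mul0r : left_zero 0 gr_mul.
Proof. by move=> x; rewrite /gr_mul msupp0 big_seq_fset0. Qed.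

Lemma gr_mulr0 : right_zero 0 gr_mul.
Proof.
move=> x; rewrite /gr_mul big1 // => g _.
by rewrite msupp0 big_seq_fset0.
Qed.

Lemma gr_mul_suml (I : Type) (r : seq I) (F : I -> RG) y :
  gr_mul (\sum_(i <- r) F i) y = \sum_(i <- r) gr_mul (F i) y.
Proof.
exact: (big_morph (gr_mul^~ y) (fun _ _ => gr_mulDl _ _ _) (gr_mul0r _)).
Qed.

Lemma gr_mul_sumr (I : Type) (r : seq I) (F : I -> RG) x :
  gr_mul x (\sum_(i <- r) F i) = \sum_(i <- r) gr_mul x (F i).
Proof.
exact: (big_morph (gr_mul x) (fun _ _ => gr_mulDr _ _ _) (gr_mulr0 _)).
Qed.

Lemma gr_sumE x : x = \sum_(g <- msupp x) gr_basis x@_g g.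
Proof. exact: monalgE. Qed.

Lemma gr_mul1r : left_id gr_one gr_mul.
Proof.
move=> x; rewrite [in LHS](gr_sumE x) gr_mul_sumr [in RHS](gr_sumE x).
by apply/eq_bigr => g _; rewrite gr_mulUU mul1r mul1g.
Qed.

Lemma gr_mulr1 : right_id gr_one gr_mul.
Proof.
move=> x; rewrite [in LHS](gr_sumE x) gr_mul_suml [in RHS](gr_sumE x).
by apply/eq_bigr => g _; rewrite gr_mulUU mulr1 mulg1.
Qed.

Lemma gr_mulA : associative gr_mul.
Proof.
move=> x y z; rewrite (gr_sumE x) !gr_mul_suml; apply/eq_bigr => g _.
rewrite (gr_sumE y) gr_mul_suml !gr_mul_sumr gr_mul_suml.
apply/eq_bigr => h _; rewrite (gr_sumE z) !gr_mul_sumr.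
by apply/eq_bigr => k _; rewrite !gr_mulUU mulrA mulgA.
Qed.

Lemma gr_one_neq0 : gr_one != 0.
Proof. by rewrite monalgU_eq0 oner_eq0. Qed.

HB.instance Definition _ := GRing.Zmodule_isNzRing.Build RG
  gr_mulA gr_mul1r gr_mulr1 gr_mulDl gr_mulDr gr_one_neq0.

Lemma gr_scale_basis c d g : c *: gr_basis d g = gr_basis (c * d) g.
Proof.
by apply/malgP => h; rewrite /gr_basis mcoeffZ !mcoeffU mulrnAr.
Qed.

Lemma gr_scaleE c x : c *: x = gr_basis c 1%g * x.
Proof.
rewrite [in LHS](gr_sumE x) scaler_sumr [in RHS](gr_sumE x) mulr_sumr.
apply/eq_bigr => g _; rewrite gr_scale_basis.
by rewrite [RHS]gr_mulUU mul1g.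
Qed.

Lemma gr_scaleAl c x y : c *: (x * y) = c *: x * y.
Proof. by rewrite !gr_scaleE mulrA. Qed.

HB.instance Definition _ := GRing.Lmodule_isLalgebra.Build R RG gr_scaleAl.

Lemma gr_basisM c1 c2 g1 g2 :
  gr_basis c1 g1 * gr_basis c2 g2 = gr_basis (c1 * c2) (g1 * g2)%g.
Proof. exact: gr_mulUU. Qed.

Definition augmentation x : R := \sum_(g <- msupp x) x@_g.

Lemma augmentationEw (d : {fset G}) x : (msupp x `<=` d)%fset ->
  augmentation x = \sum_(g <- d) x@_g.
Proof. by move=> le_d; apply/big_fset_incl => // g _ /mcoeff_outdom. Qed.

Lemma augmentation_is_zmod_morphism : zmod_morphism augmentation.
Proof.
move=> x y; rewrite (augmentationEw (msuppB_le x y)).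
rewrite (augmentationEw (fsubsetUl (msupp x) (msupp y))).
rewrite (augmentationEw (fsubsetUr (msupp x) (msupp y))) -sumrB.
by apply/eq_bigr => g _; rewrite mcoeffB.
Qed.

HB.instance Definition _ := GRing.isZmodMorphism.Build RG R augmentation
  augmentation_is_zmod_morphism.

Lemma augmentation_basis c g : augmentation (gr_basis c g) = c.
Proof. by rewrite (augmentationEw msuppU_le) big_seq_fset1 mcoeffUU. Qed.

Lemma augmentation_is_monoid_morphism : monoid_morphism augmentation.
Proof.
split=> [|x y]; first exact: augmentation_basis.
rewrite [X in augmentation X]/(gr_mul x y) /gr_mul raddf_sum mulr_suml.
apply/eq_bigr => g _; rewrite raddf_sum /= mulr_sumr.
by apply/eq_bigr => h _; rewrite augmentation_basis.
Qed.

HB.instance Definition _ := GRing.isMonoidMorphism.Build RG R augmentation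
  augmentation_is_monoid_morphism.

Lemma augmentationZ : scalable_for *%R augmentation.
Proof. by move=> c x; rewrite gr_scaleE rmorphM /= augmentation_basis. Qed.

HB.instance Definition _ := GRing.isScalable.Build R RG R *%R augmentation
  augmentationZ.

End GroupRing.

Lemma gr_mulC (R : comNzRingType) (G : groupType) :
  (forall g h : G, commute g h) ->
  forall x y : group_ring R G, x * y = y * x.
Proof.
move=> abG x y; rewrite (gr_sumE x) (gr_sumE y) mulr_suml mulr_sumr.
apply/eq_bigr => g _; rewrite mulr_suml mulr_sumr; apply/eq_bigr => h _.
by rewrite !gr_basisM mulrC abG.
Qed.

Section Groups.
Context {G : groupType}.

Definition is_subgroup (N : set G) : Prop :=
  [/\ N 1%g, forall g h, N g -> N h -> N (g * h)%g
    & forall g, N g -> N (g^-1)%g].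

Definition has_order (g : G) (n : nat) : Prop :=
  [/\ (0 < n)%N, (g ^+ n)%g = 1%g
    & forall m, (0 < m)%N -> (g ^+ m)%g = 1%g -> (n <= m)%N].

Definition p_component (p : nat) : set G :=
  [set g | exists k, has_order g (p ^ k)].

End Groups.

Arguments p_component : clear implicits.

Definition supp (G : groupType) : set nat :=
  [set p | prime p /\ p_component G p <> [set 1%g]].

Section Rings.
Context {A : nzRingType}.

Definition is_ideal (J : set A) : Prop :=
  [/\ J 0, forall x y, J x -> J y -> J (x + y)
    & forall a x, J x -> J (a * x) /\ J (x * a)].

End Rings.

(* The nilpotent elements; this is the nilradical when A is commutative. *)
Definition nilradical (A : nzRingType) : set A :=
  [set x | exists n, x ^+ n = 0].

Arguments nilradical : clear implicits.

Definition reduced (A : nzRingType) : Prop := nilradical A = [set 0].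

Section Ideals.
Context (R : nzRingType) {G : groupType}.

(* RN, identified with the elements of RG supported in N. *)
Definition sub_group_ring (N : set G) : set (group_ring R G) :=
  [set x | forall g, g \in msupp x -> N g].

Definition augmentation_ideal (N : set G) : set (group_ring R G) :=
  [set x | sub_group_ring N x /\ augmentation x = 0].

Definition Phi (N : set G) : set (group_ring R G) :=
  smallest is_ideal (augmentation_ideal N).

End Ideals.

Arguments sub_group_ring R {G} N.
Arguments augmentation_ideal R {G} N.
Arguments Phi R {G} N.

(* Main.v *)
Require Import Defs.
From HB Require Import structures.
From mathcomp Require Import all_boot all_algebra.
From mathcomp Require Import boolp classical_sets.
From mathcomp Require Import finmap.
From mathcomp.multinomials Require Import monalg.

(** Two computations carry the equivalence.

    In prime characteristic p, raising to the power q = p ^ k is additive on RG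
    and on R.  Hence g - 1 is nilpotent when g has order a power of p, which
    puts Phi(G_p) inside the nilradical.  Conversely, for R reduced, if
    x = sum x_g g satisfies x ^ q = 0, comparing coefficients in
    sum (x_g)^q g^q = 0 shows that the q-th power of each fibre sum
    sum_(g^q = h) x_g is zero, so the fibre sum itself is zero because R is
    reduced ([nilpotent_fibre_sum]).  Two elements of the same fibre of
    g |-> g^q have their quotient in G_p; replacing every g by a chosen
    representative of its fibre therefore changes x by an element of Phi(G_p)
    only, and turns x into 0 ([nilradical_sub_Phi]).

    Now let the nilradical be Phi(N), with N <> 1.  Constants in Phi(N) have
    augmentation 0, so R is reduced.  Take g <> 1 in N: the element u = g - 1 is
    nilpotent.  A last nonzero power of u is fixed by multiplication by g, and
    its support is finite, so g has finite order ([nilpotent_torsion]); some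
    power of g, still in N, then has prime order p, and g may be replaced by it.
    From g^p = 1 it follows that u * s = 0 with s = 1 + g + ... + g^(p-1), and
    s is congruent to p modulo u; so p^n is congruent to a multiple of u^n
    modulo the annihilator of u.  As u is nilpotent, p^n u = 0 for some n
    ([natr_kills_unipotent]); reading the coefficient at g gives p^n = 0 in R,
    thus p = 0 since R is reduced ([natr_eq0_of_nilradical_Phi]). *)

Set Implicit Arguments.
Unset Strict Implicit.
Unset Printing Implicit Defensive.

Import GRing.Theory.

Local Open Scope classical_set_scope.
Local Open Scope ring_scope.

(** * Rings with commuting elements *)

Section CommutingRing.
Variable A : nzRingType.
(* Commutativity is a hypothesis on A because the group ring of an abelian
   group carries only the structure of a noncommutative ring. *)
Hypothesis mulAC : forall x y : A, x * y = y * x.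

Lemma nilradical_ideal : is_ideal (nilradical A).
Proof.
split; first by exists 1%N; rewrite expr1.
- move=> x y [m xm0] [n yn0]; exists (m + n)%N.
  rewrite exprDn_comm; last exact: mulAC.
  rewrite big1 // => i _; case: (leqP n i) => [le_ni | lt_in].
    by rewrite -(subnKC le_ni) exprD yn0 mul0r mulr0 mul0rn.
  have le_m : (m <= m + n - i)%N by rewrite -addnBA ?leq_addr // ltnW.
  by rewrite -(subnKC le_m) exprD xm0 !mul0r mul0rn.
- move=> a x [n xn0]; have nil_ax : nilradical A (a * x).
    by exists n; rewrite exprMn_comm ?xn0 ?mulr0 //; exact: mulAC.
  by split=> //; rewrite mulAC.
Qed.

Section PrimeCharacteristicPower.
Variables (p : nat) (charAp : p \in [pchar A]) (k : nat).

Lemma exprD_pchar_pow (x y : A) :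
  (x + y) ^+ (p ^ k) = x ^+ (p ^ k) + y ^+ (p ^ k).
Proof.
elim: k => [|j IHj]; first by rewrite expn0 !expr1.
rewrite expnSr !exprM IHj -!(pFrobenius_autE charAp).
by rewrite pFrobenius_autD_comm //; exact: mulAC.
Qed.

Lemma expr_sum_pchar (I : Type) (r : seq I) (P : pred I) (F : I -> A) :
  (\sum_(i <- r | P i) F i) ^+ (p ^ k) = \sum_(i <- r | P i) F i ^+ (p ^ k).
Proof.
have q_neq0 : (p ^ k)%N != 0%N.
  by rewrite expn_eq0 negb_and -lt0n prime_gt0 ?(pcharf_prime charAp).
apply: (big_morph (fun x => x ^+ (p ^ k)) exprD_pchar_pow).
by rewrite expr0n (negbTE q_neq0).
Qed.

End PrimeCharacteristicPower.

(** With u = g - 1 and s = 1 + g + ... + g^(m-1), the hypothesis on g says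
    u s = 0, while m - s is a multiple of u. So modulo the annihilator of u,
    m^n is congruent to a multiple of u^n. *)
Lemma natr_kills_unipotent (g : A) m n :
  g ^+ m = 1 -> (g - 1) ^+ n = 0 -> (g - 1) * m%:R ^+ n = 0.
Proof.
move=> gm1 un0; set u := g - 1 in un0 *; set s := \sum_(i < m) g ^+ i.
have us0 : u * s = 0 by rewrite -subrX1 gm1 subrr.
have [t def_m] : exists t, m%:R - u * t = s.
  exists (- \sum_(i < m) \sum_(j < i) g ^+ j).
  rewrite mulrN opprK mulr_sumr.
  rewrite -[m in m%:R]card_ord -sumr_const -big_split /=.
  by apply: eq_bigr => i _; rewrite -subrX1 addrC subrK.
have /eqP := @subrXX_comm _ m%:R (u * t) n (mulAC _ _).
rewrite [(u * t) ^+ n]exprMn_comm ?un0; last exact: mulAC.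
by rewrite mul0r subr0 def_m => /eqP ->; rewrite mulrA us0 mul0r.
Qed.

End CommutingRing.

Lemma ideal_sum (A : nzRingType) (J : set A) (I : eqType) (r : seq I)
    (F : I -> A) :
  is_ideal J -> (forall i, i \in r -> J (F i)) -> J (\sum_(i <- r) F i).
Proof.
move=> [J0 JD _] JF; rewrite big_seq.
exact: (big_ind (fun x => J x) J0 JD JF).
Qed.

Lemma reduced_expr_eq0 (R : nzRingType) (c : R) n :
  reduced R -> c ^+ n = 0 -> c = 0.
Proof.
move=> redR cn0; suff : nilradical R c by rewrite redR.
by exists n.
Qed.

(** * Torsion in groups *)

Section Torsion.
Variable G : groupType.
Implicit Types (g h : G) (N : set G).

Lemma subgroupX N g k : is_subgroup N -> N g -> N (g ^+ k)%g.
Proof.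
move=> [N1 NM _] Ng; elim: k => [|k IHk]; first by rewrite expg0.
by rewrite expgS; apply: NM.
Qed.

Lemma p_componentP p g :
  prime p -> p_component G p g <-> exists k, (g ^+ (p ^ k))%g = 1%g.
Proof.
move=> pr_p; split=> [[k [_ gk1 _]]|[k gk1]]; first by exists k.
have ex_m : exists m, (0 < m)%N && ((g ^+ m)%g == 1%g).
  by exists (p ^ k)%N; rewrite expn_gt0 prime_gt0 // gk1 eqxx.
case: (ex_minnP ex_m) => d /andP[d_gt0 /eqP gd1] d_min.
have /(dvdn_pfactor _ _ pr_p)[j _ def_d] : (d %| p ^ k)%N.
  rewrite /dvdn; have [//|r_gt0] := posnP (p ^ k %% d)%N.
  have : (d <= p ^ k %% d)%N.
    apply: d_min; rewrite r_gt0 /=; move: gk1.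
    rewrite {1}(divn_eq (p ^ k) d) expgnDr mulnC expgnA gd1 expg1n mul1g.
    by move=> ->.
  by rewrite leqNgt ltn_pmod.
exists j; rewrite -def_d; split=> // m m_gt0 gm1.
by apply: d_min; rewrite m_gt0 gm1 eqxx.
Qed.

Lemma p_component_subgroup p :
  (forall g h, commute g h) -> prime p -> is_subgroup (p_component G p).
Proof.
move=> abG pr_p; split.
- by apply/p_componentP => //; exists 0; rewrite expg1n.
- move=> g h /(p_componentP _ pr_p)[j gj1] /(p_componentP _ pr_p)[k hk1].
  apply/p_componentP => //; exists (j + k)%N.
  rewrite expgMn // expnD expgnA gj1 expg1n mul1g.
  by rewrite mulnC expgnA hk1 expg1n.
- move=> g /(p_componentP _ pr_p)[k gk1].
  by apply/p_componentP => //; exists k; rewrite expVgn gk1 invg1.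
Qed.

(** Descend from m to m / p, for a prime divisor p of m, as long as g to the
    power m / p is 1; the descent stops before m = 1 because g <> 1. *)
Lemma prime_order_power g m :
    (0 < m)%N -> (g ^+ m)%g = 1%g -> g <> 1%g ->
  exists p k, [/\ prime p, (g ^+ k)%g <> 1%g & ((g ^+ k) ^+ p)%g = 1%g].
Proof.
move: {2}m (leqnn m) => b; elim: b m => [|b IHb] m le_mb m_gt0 gm1 g_neq1.
  by rewrite leqNgt m_gt0 in le_mb.
have m_gt1 : (1 < m)%N.
  rewrite ltn_neqAle m_gt0 andbT; apply: contra_not_neq g_neq1 => m1.
  by rewrite -m1 expg1 in gm1.
have pr_p := pdiv_prime m_gt1.
have [gd1 | gd_neq1] := pselect ((g ^+ (m %/ pdiv m))%g = 1%g).
  apply: (IHb (m %/ pdiv m)%N) => //.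
    by rewrite -ltnS (leq_trans _ le_mb) // ltn_Pdiv // prime_gt1.
  by rewrite divn_gt0 ?pdiv_gt0 // pdiv_leq.
exists (pdiv m), (m %/ pdiv m)%N; split=> //.
by rewrite -expgnA divnK ?pdiv_dvd.
Qed.

End Torsion.

(** * The group ring *)

Section GroupRingTheory.
Variables (R : nzRingType) (G : groupType).
Local Notation RG := (group_ring R G).
Local Notation "[ g ]" := (gr_basis 1 g : RG) (at level 0, g at level 99).
Implicit Types (x y : RG) (g h : G) (c : R) (N : set G).

Lemma gr_basisX c g n : gr_basis c g ^+ n = gr_basis (c ^+ n) (g ^+ n)%g.
Proof. by elim: n => [//|n IHn]; rewrite !exprS IHn gr_basisM expgS. Qed.

Lemma mcoeff_basisMl g h x : ([g] * x)@_(g * h)%g = x@_h.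
Proof.
rewrite [in RHS](gr_sumE x) [in LHS](gr_sumE x) mulr_sumr !raddf_sum /=.
apply: eq_bigr => k _; rewrite gr_basisM mul1r !mcoeffU.
by rewrite (inj_eq (mulgI g)).
Qed.

Lemma pchar_group_ring p : p \in [pchar R] -> p \in [pchar RG].
Proof.
rewrite !inE => /andP[-> /eqP p0] /=; apply/eqP.
by rewrite -scaler_nat p0 scale0r.
Qed.

(** The translates g^i h of a support element h stay in the finite support of
    x, so two of them coincide. *)
Lemma torsion_of_fixed g x :
  x <> 0 -> [g] * x = x -> exists2 m, (0 < m)%N & (g ^+ m)%g = 1%g.
Proof.
move=> x_neq0 gx.
have [h supp_h] : exists h, h \in msupp x.
  apply: contrapT => no_h; apply: x_neq0; apply/malgP => h; rewrite mcoeff0.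
  by apply/mcoeff_outdom/negP => supp_h; apply: no_h; exists h.
have supp_gh i : (g ^+ i * h)%g \in msupp x.
  elim: i => [|i IHi]; first by rewrite expg0 mul1g.
  by rewrite -mcoeff_neq0 expgS -mulgA -gx mcoeff_basisMl mcoeff_neq0.
pose s := mkseq (fun i => (g ^+ i * h)%g) (size (msupp x)).+1.
have not_uniq : ~~ uniq s.
  apply/negP => uniq_s.
  have : {subset s <= msupp x} by move=> _ /mapP[i _ ->].
  by move=> /(uniq_leq_size uniq_s); rewrite size_mkseq ltnn.
have /(uniqPn 1%g)[i [j [lt_ij]]] := not_uniq.
rewrite size_mkseq => lt_j; rewrite !nth_mkseq ?(ltn_trans lt_ij) //.
move=> /mulIg eq_ij; exists (j - i)%N; first by rewrite subn_gt0.
by rewrite expgnFr ?(ltnW lt_ij) // -eq_ij mulgV.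
Qed.

Lemma nilpotent_torsion g n :
  ([g] - 1) ^+ n = 0 -> exists2 m, (0 < m)%N & (g ^+ m)%g = 1%g.
Proof.
move=> un0.
(* Generalize from 1 to any x <> 0 killed by a power of g - 1: then either
   g - 1 kills x, or one factor g - 1 can be moved into x. *)
suff annihilated x : x <> 0 -> ([g] - 1) ^+ n * x = 0 ->
    exists2 m, (0 < m)%N & (g ^+ m)%g = 1%g.
  by apply: (annihilated 1); [apply/eqP/oner_neq0 | rewrite un0 mul0r].
elim: n x {un0} => [|n IHn] x x_neq0; first by rewrite expr0 mul1r.
rewrite exprSr -mulrA => un0.
have [/eqP | ux_neq0] := pselect (([g] - 1) * x = 0).
  by rewrite mulrBl mul1r subr_eq0 => /eqP; apply: torsion_of_fixed.
exact: IHn ux_neq0 un0.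
Qed.

Lemma Phi_ideal N : is_ideal (Phi R N).
Proof.
split.
- by move=> J [[]].
- move=> x y xN yN J NJ; have [[_ JD _] _] := NJ.
  by apply: JD; [exact: xN | exact: yN].
- move=> a x xN; split=> J NJ; have [[_ _ JM] _] := NJ;
    by have [] := JM a _ (xN _ NJ).
Qed.

Lemma augmentation_Phi N x : Phi R N x -> augmentation x = 0.
Proof.
have ker_ideal : is_ideal [set y : RG | augmentation y = 0].
  split=> /=; first by rewrite raddf0.
    by move=> y z y0 z0; rewrite raddfD /= y0 z0 addr0.
  by move=> a y y0; rewrite !rmorphM /= y0 mulr0 mul0r.
by move=> /(_ [set y | augmentation y = 0]); apply; split=> // y [].
Qed.

(** h - g = g (g^-1 h - 1), a multiple of a generator. *)
Lemma Phi_basisB N g h :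
  is_subgroup N -> N (g^-1 * h)%g -> Phi R N ([h] - [g]).
Proof.
move=> [N1 _ _] Ngh; have [_ _ PhiM] := Phi_ideal N.
suff : Phi R N ([g^-1 * h]%g - 1).
  by move=> /PhiM -/(_ [g])[]; rewrite mulrBr mulr1 gr_basisM mul1r mulVKg.
apply: sub_gen_smallest; split; last first.
  by rewrite raddfB /= augmentation_basis rmorph1 subrr.
move=> k /(fsubsetP (msuppB_le _ _)); rewrite in_fsetU.
by move=> /orP[] /(fsubsetP msuppU_le); rewrite in_fset1 => /eqP ->.
Qed.

End GroupRingTheory.

Local Notation "[ g ]" := (gr_basis 1 g) (at level 0, g at level 99).

(** * The nilradical of the group ring in prime characteristic *)

Section PrimeCharacteristic.
Variables (R : comNzRingType) (G : groupType).
Hypothesis abG : forall g h : G, commute g h.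
Variable p : nat.
Hypothesis charRp : p \in [pchar R].
Local Notation RG := (group_ring R G).

Let pr_p : prime p := pcharf_prime charRp.

Lemma group_ring_exprp (x : RG) k :
  x ^+ (p ^ k) =
    \sum_(g <- msupp x) gr_basis (x@_g ^+ (p ^ k)) (g ^+ (p ^ k))%g.
Proof.
rewrite [in LHS](gr_sumE x).
rewrite (expr_sum_pchar (gr_mulC abG) (pchar_group_ring G charRp)).
by apply: eq_bigr => g _; rewrite gr_basisX.
Qed.

(** An element of the augmentation ideal of G_p is a combination of elements
    g - 1 with g in G_p, and (g - 1)^q = g^q - 1 = 0 once q is a power of p
    divisible by the order of g. *)
Lemma Phi_sub_nilradical : Phi R (p_component G p) `<=` nilradical RG.
Proof.
have nil_ideal := nilradical_ideal (gr_mulC (R := R) abG).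
have [_ _ nilM] := nil_ideal.
apply: (smallest_sub nil_ideal) => x [suppx augx].
have -> : x = \sum_(g <- msupp x) x@_g *: ([g] - 1).
  rewrite [in LHS](gr_sumE x); under [RHS]eq_bigr do rewrite scalerBr.
  rewrite sumrB -scaler_suml [X in X *: 1]augx scale0r subr0.
  by apply: eq_bigr => g _; rewrite gr_scale_basis mulr1.
apply: (ideal_sum nil_ideal) => g /suppx/(p_componentP _ pr_p)[k gk1].
rewrite gr_scaleE; apply: (nilM _ _ _).1; exists (p ^ k)%N.
apply: (addIr 1); rewrite add0r -[X in _ + X = _](expr1n RG (p ^ k)).
rewrite -(exprD_pchar_pow (gr_mulC abG) (pchar_group_ring G charRp)) subrK.
by rewrite gr_basisX expr1n gk1.
Qed.

(** For q = p^k, the q-th power of this fibre sum is the coefficient of x^q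
    at h. *)
Lemma nilpotent_fibre_sum (x : RG) k h :
  reduced R -> x ^+ (p ^ k) = 0 ->
  \sum_(g <- msupp x | (g ^+ (p ^ k))%g == h) x@_g = 0.
Proof.
move=> redR xq0; apply: (@reduced_expr_eq0 _ _ (p ^ k) redR).
rewrite (expr_sum_pchar (@mulrC R) charRp) big_mkcond /=.
have := congr1 (mcoeff h) xq0.
rewrite group_ring_exprp mcoeff0 raddf_sum /= => coef0; rewrite -[RHS]coef0.
by apply: eq_bigr => g _; rewrite mcoeffU; case: eqP.
Qed.

(** Let r g be the chosen representative of the fibre of g |-> g^q through g,
    where x^q = 0. Then sum x_g r(g) groups into vanishing fibre sums, so x is
    equal to sum x_g (g - r(g)), and each r(g)^-1 g is killed by q. *)
Lemma nilradical_sub_Phi :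
  reduced R -> nilradical RG `<=` Phi R (p_component G p).
Proof.
move=> redR x [n xn0].
have xq0 : x ^+ (p ^ n) = 0.
  by rewrite -(subnKC (ltnW (ltn_expl n (prime_gt1 pr_p)))) exprD xn0 mul0r.
set q := (p ^ n)%N in xq0.
(* r picks one element in each fibre of g |-> g^q, the same for the whole fibre;
   g is only the default that [choose] asks for. *)
pose fibre h : pred G := fun g => (g ^+ q)%g == h.
pose r g := choose (fibre (g ^+ q)%g) g.
have rq g : (r g ^+ q)%g = (g ^+ q)%g.
  by apply/eqP; apply: (@chooseP _ (fibre (g ^+ q)%g) g); rewrite /fibre.
have eq_r g h : (g ^+ q)%g = (h ^+ q)%g -> r g = r h.
  by move=> eq_q; rewrite /r eq_q; apply: choose_id; rewrite /fibre ?eq_q.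
have sum_r0 : \sum_(g <- msupp x) gr_basis x@_g (r g) = 0.
  apply/malgP => h; rewrite raddf_sum mcoeff0 /=.
  under eq_bigr do rewrite mcoeffU.
  have [rh | rh] := eqVneq (r h) h; last first.
    apply: big1 => g _; have [rgh|//] := eqVneq (r g) h.
    by case/eqP: rh; rewrite -[in RHS]rgh; apply: eq_r; rewrite -rgh rq.
  rewrite -[RHS](nilpotent_fibre_sum (h ^+ q)%g redR xq0) [RHS]big_mkcond /=.
  apply: eq_bigr => g _; have [/eq_r rgh | gh] := eqVneq (g ^+ q)%g (h ^+ q)%g.
    by rewrite rgh rh eqxx.
  by have [rgh|//] := eqVneq (r g) h; rewrite -rgh rq eqxx in gh.
have -> : x = \sum_(g <- msupp x) x@_g *: ([g] - [r g]).
  under eq_bigr do rewrite scalerBr !gr_scale_basis !mulr1.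
  by rewrite sumrB sum_r0 subr0 -gr_sumE.
apply: (ideal_sum (Phi_ideal _ _)) => g _.
have [_ _ PhiM] := Phi_ideal R (p_component G p).
rewrite gr_scaleE; apply: (PhiM _ _ _).1; apply: Phi_basisB.
  exact: p_component_subgroup.
apply/p_componentP => //; exists n.
by rewrite expgMn // expVgn rq mulVg.
Qed.

End PrimeCharacteristic.

(** * The nilradical as an ideal induced from a subgroup *)

Section InducedNilradical.
Variables (R : comNzRingType) (G : groupType).
Hypothesis abG : forall g h : G, commute g h.
Local Notation RG := (group_ring R G).
Variable N : set G.
Hypothesis nilN : nilradical RG = Phi R N.

(** A nilpotent constant lies in Phi(N), hence has augmentation 0, and the
    augmentation of a constant is the constant itself. *)
Lemma reduced_of_nilradical_Phi : reduced R.
Proof.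
apply/seteqP; split=> c /=; last by move=> ->; exists 1%N; rewrite expr1.
move=> [n cn0]; rewrite -(augmentation_basis c (1%g : G)).
apply: (@augmentation_Phi _ _ N); rewrite -nilN; exists n.
by rewrite gr_basisX cn0 /gr_basis monalgU0.
Qed.

(** Reading the coefficient at g in m^n (g - 1) = 0. *)
Lemma natr_eq0_of_nilradical_Phi g m :
    is_subgroup N -> N g -> g <> 1%g -> (g ^+ m)%g = 1%g ->
  m%:R = 0 :> R.
Proof.
move=> subN Ng g_neq1 gm1.
have [n un0] : nilradical RG ([g] - 1).
  by rewrite nilN; apply: Phi_basisB => //; rewrite invg1 mul1g.
apply: (@reduced_expr_eq0 _ _ n reduced_of_nilradical_Phi).
have basis_gm1 : [g] ^+ m = 1 :> RG by rewrite gr_basisX expr1n gm1.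
have := natr_kills_unipotent (gr_mulC abG) basis_gm1 un0.
rewrite -natrX mulr_natr => /(congr1 (mcoeff g)).
rewrite mcoeff0 mcoeffMn mcoeffB !mcoeffU eqxx.
by case: eqP => [/esym //|_]; rewrite subr0 -natrX.
Qed.

Lemma prime_torsion_of_nilradical_Phi :
  is_subgroup N -> N <> [set 1%g] ->
  exists p, p \in [pchar R] /\ supp G p.
Proof.
move=> subN N_neq1.
have [g Ng g_neq1] : exists2 g, N g & g <> 1%g.
  apply: contrapT => noN; apply: N_neq1; apply/seteqP; split=> g /=.
    by move=> Ng; apply: contrapT => g_neq1; apply: noN; exists g.
  by move=> ->; case: subN.
have [n un0] : nilradical RG ([g] - 1).
  by rewrite nilN; apply: Phi_basisB => //; rewrite invg1 mul1g.
have [m m_gt0 gm1] := nilpotent_torsion un0.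
have [p [k [pr_p h_neq1 hp1]]] := prime_order_power m_gt0 gm1 g_neq1.
exists p; split.
  rewrite inE pr_p; apply/eqP.
  exact: (natr_eq0_of_nilradical_Phi subN (subgroupX k subN Ng) h_neq1 hp1).
split=> // Gp1; apply: h_neq1.
suff : p_component G p (g ^+ k)%g by rewrite Gp1.
by apply/p_componentP => //; exists 1%N; rewrite expn1.
Qed.

End InducedNilradical.

Theorem proposition2p2 (R : comNzRingType) (G : groupType)
    (abG : forall g h : G, commute g h) :
  ((exists N : set G,
      [/\ is_subgroup N, N <> [set 1%g]
        & nilradical (group_ring R G) = Phi R N])
   <->
   (reduced R /\ exists p : nat, p \in [pchar R] /\ supp G p))
  /\
  (forall p : nat, reduced R -> p \in [pchar R] -> supp G p ->
     nilradical (group_ring R G) = Phi R (p_component G p)).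
Proof.
have nil_Gp p : reduced R -> p \in [pchar R] ->
    nilradical (group_ring R G) = Phi R (p_component G p).
  move=> redR charRp; apply/seteqP; split.
    exact: nilradical_sub_Phi.
  exact: Phi_sub_nilradical.
split=> [|p redR charRp _]; last exact: nil_Gp.
split=> [[N [subN N_neq1 nilN]] | [redR [p [charRp [pr_p Gp_neq1]]]]].
  split; first exact: reduced_of_nilradical_Phi nilN.
  exact: (prime_torsion_of_nilradical_Phi abG nilN).
exists (p_component G p); split=> //; last exact: nil_Gp.
exact: p_component_subgroup.
Qed.
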